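(* Let $Q$ be a countable better quasi-order. If $Q$ is thin, then $Q^{<\omega}$, ordered by the Higman order, is thin.
   Context: A quasi-order is a set (or class) $Q$ with a reflexive transitive relation $\leqq_Q$. $[\omega]^\omega$ is the set of infinite subsets of $\omega$, identified with strictly increasing sequences and topologized as a subspace of $\omega^\omega$; for infinite $A\subseteq\omega$, $[A]^\omega$ is the set of infinite subsets of $A$. A quasi-order $Q$ is a better quasi-order (BQO) if, giving $Q$ the discrete topology, for every Borel map $f:[\omega]^\omega\to Q$ there is $A\in[\omega]^\omega$ such that $f(B)\leqq_Q f(B\setminus\{\min B\})$ for all $B\in[A]^\omega$. A Borel graph is a pair $(V,E)$ with $V$ Polish and $E\subseteq[V]^2$ Borel. Its Borel chromatic number $\chi_B$ is the least cardinality $|Y|$ of a Polish space $Y$ for which there is a Borel map $V\to Y$ sending adjacent vertices to distinct points. For a countable BQO $Q$, let $\vec Q=\{X\in Q^\omega:\forall k\in\omega,\ X(k)\not\leqq_Q X(k+1)\}$ (subspace of $Q^\omega$ with the product of discrete topologies), regarded as a Borel graph in which distinct $X,Y$ are adjacent iff $S(X)=Y$ or $S(Y)=X$, where $S(X)(k)=X(k+1)$. A countable BQO $Q$ is thin if $\chi_B(\vec Q)\leq 3$. A BQO (set or class) that is not assumed countable is called thin if every countably infinite subset of it, with the induced order, is thin. $Q^{<\omega}$ is the set of finite sequences of elements of $Q$ (functions from some $\{0,\dots,n\}$ to $Q$). The Higman order on it: $t_1\leqq t_2$ iff there is a strictly increasing $h:\mathrm{dom}(t_1)\to\mathrm{dom}(t_2)$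 with $t_1(i)\leqq_Q t_2(h(i))$ for all $i\in\mathrm{dom}(t_1)$. *)

(* Defs.v *)
From HB Require Import structures.
From mathcomp Require Import all_boot all_order all_algebra.
From mathcomp Require Import all_classical all_reals all_analysis.
Set Implicit Arguments.
Unset Strict Implicit.
Unset Printing Implicit Defensive.
Import Order.TTheory.
Local Open Scope classical_set_scope.
Local Open Scope card_scope.

(* Quasi-orders are MathComp's preorderType.                                  *)

Definition borel (T : topologicalType) : set (set T) := <<s open >>.

Definition borel_map (S T : topologicalType) (f : S -> T) : Prop :=
  forall B, borel B -> borel (f @^-1` B).

(* Separable and homeomorphic to a complete metric space; the empty space is  *)
(* allowed, since the vertex set [bad_seq Q] below may be empty.              *)
Definition polish (R : realType) (T : topologicalType) : Prop :=
  (exists2 D : set T, countable D & dense D) /\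
  exists (M : metricType R) (f : T -> M),
    [/\ bijective f,
        forall U : set M, open U <-> open (f @^-1` U)
      & forall u : nat -> M, cauchy (u @ \oo) -> exists l : M, u @ \oo --> l].

Definition borel_colorable_by (R : realType) (V : topologicalType)
    (E : V -> V -> Prop) (Y : topologicalType) : Prop :=
  polish R Y /\
  exists2 c : V -> Y, borel_map c & forall x y, E x y -> c x <> c y.

(* The least cardinality, as a relation: Y attains the Borel chromatic number *)
(* of (V, E), i.e. has that cardinality.                                      *)
Definition borel_chromatic_number (R : realType) (V : topologicalType)
    (E : V -> V -> Prop) (Y : topologicalType) : Prop :=
  borel_colorable_by R E Y /\
  forall Z : topologicalType,
    borel_colorable_by R E Z -> [set: Y] #<= [set: Z].

Definition borel_chromatic_number_le (R : realType) (V : topologicalType)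
    (E : V -> V -> Prop) (n : nat) : Prop :=
  exists2 Y : topologicalType,
    borel_chromatic_number R E Y & [set: Y] #<= [set: 'I_n].

Definition shift (T : Type) (s : nat -> T) : nat -> T := fun k => s k.+1.

(* An infinite subset of nat is represented by its increasing enumeration, so *)
(* the set is the range of the sequence.                                      *)
Definition strictly_increasing : set {ptws nat -> nat} :=
  [set s | forall k, (s k < s k.+1)%N].

Definition infset : topologicalType := set_type strictly_increasing.

Definition set_of_infset (A : infset) : set nat := range (set_val A).

Lemma shift_strictly_increasing (A : infset) :
  shift (set_val A) \in strictly_increasing.
Proof. by apply/mem_set => k; exact: (set_valP A). Qed.

Definition remove_min (A : infset) : infset :=
  exist _ (shift (set_val A)) (shift_strictly_increasing A).

Lemma set_of_remove_min (A : infset) :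
  set_of_infset (remove_min A) = set_of_infset A `\ set_val A 0%N /\
  forall k, set_of_infset A k -> (set_val A 0 <= k)%N.
Proof.
have incrA : {homo (set_val A : nat -> nat) : i j / (i < j)%N}.
  by apply: homo_ltn; [exact: ltn_trans | exact: (set_valP A)].
split; last first.
  by move=> _ [[|k] _ <-] //; apply/ltnW/incrA.
apply/seteqP; split => [_ [k _ <-]|_ [[[|k] _ <-]]] //=.
- split; first by exists k.+1.
  move=> eqA0; have := incrA 0%N k.+1 isT.
  by rewrite [X in (_ < X)%N](eqA0 : set_val A k.+1 = _) ltnn.
- by exists k.
Qed.

Definition bqo (d : Order.disp_t) (Q : preorderType d) : Prop :=
  forall f : infset -> discrete_topology Q, borel_map f ->
    exists A : infset, forall B : infset,
      set_of_infset B `<=` set_of_infset A ->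
      ((f B : Q) <= (f (remove_min B) : Q))%O.

Section BadSequences.
Context (d : Order.disp_t) (Q : preorderType d).

Definition bad_seq_set : set {ptws nat -> discrete_topology Q} :=
  [set X | forall k, ~~ ((X k : Q) <= (X k.+1 : Q))%O].

Definition bad_seq : topologicalType := set_type bad_seq_set.

Definition bad_seq_adj (X Y : bad_seq) : Prop :=
  X <> Y /\
  (shift (set_val X) = set_val Y \/ shift (set_val Y) = set_val X).

End BadSequences.

(* Thinness is a property of countable better quasi-orders, so being one is   *)
(* part of the predicate.                                                     *)
Definition thin (R : realType) (d : Order.disp_t) (Q : preorderType d) : Prop :=
  [/\ countable [set: Q], bqo Q
    & borel_chromatic_number_le R (@bad_seq_adj d Q) 3].

(* Functions from some {0, ..., n} to Q, hence nonempty sequences.            *)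
Definition finseq (Q : Type) : Type := {n : nat & {ffun 'I_n.+1 -> Q}}.

HB.instance Definition _ (Q : choiceType) :=
  Choice.copy (finseq Q) {n : nat & {ffun 'I_n.+1 -> Q}}.

Section Higman.
Context (d : Order.disp_t) (Q : preorderType d).

Definition higman_le (t1 t2 : finseq Q) : bool :=
  `[< exists h : 'I_(tag t1).+1 -> 'I_(tag t2).+1,
        {homo h : i j / (i < j)%N} /\
        forall i, (tagged t1 i <= tagged t2 (h i))%O >].

Lemma higman_le_refl : reflexive higman_le.
Proof. by move=> t; apply/asboolP; exists id; split. Qed.

Lemma higman_le_trans : transitive higman_le.
Proof.
move=> t2 t1 t3 /asboolP[h [hlt hle]] /asboolP[g [glt gle]].
apply/asboolP; exists (g \o h); split=> [i j /hlt /glt //|i] /=.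
exact: le_trans (hle i) (gle (h i)).
Qed.

HB.instance Definition _ :=
  Order.Le_isPreorder.Build d (finseq Q) higman_le_refl higman_le_trans.

End Higman.

(* Main.v *)
From HB Require Import structures.
Require Import Defs.
From mathcomp Require Import all_boot all_order all_algebra.
From mathcomp Require Import all_classical all_reals all_analysis.
Local Open Scope classical_set_scope.

Set Implicit Arguments.
Unset Strict Implicit.
Unset Printing Implicit Defensive.
Import Order.TTheory.
Local Open Scope card_scope.
(* Not the translation of a group, which has the same name. *)
Local Notation shift := Defs.shift.

(** Write a bad sequence of finite sequences as X_0, X_1, ... with X_k never
    below X_(k+1) in the Higman order.  Consider the families of starting
    points a = (a_k) such that for every k the tail of X_k from a_k does not
    embed in the tail of X_(k+1) from a_(k+1).  The zero family is one of
    them.  Dropping entries on the right of a failed embedding keeps it failed,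
    so this set of families is closed under pointwise maxima; and a failed
    embedding has a nonempty source, so a_k stays below the length of X_k.
    Hence there is a greatest family a*, its value at k is a decreasing limit
    of quantities that depend on finitely many X_i, and the passage from X to
    a* commutes with the shift.  Let y_k be the entry of X_k at a*_k.  If y
    were increasing from some N on, then deleting the first entry of all the
    tails from N on would keep every embedding failed, against the maximality
    of a*; so y_k fails to be below y_(k+1) for infinitely many k
    [lead_infinitely_bad].  This is a Borel, shift-equivariant map from bad
    sequences of finite sequences to sequences in Q, and both parts of the
    theorem follow from it.

    Colouring [shift_colorable_finseq].  If y is eventually bad, a Borel
    3-colouring of the bad sequences of Q colours the first bad tail of y, and
    the colours are propagated backwards along the orbit by a fixed-point-free
    permutation of the three colours.  Otherwise good and bad steps both occur
    infinitely often in y, and the positions where a good step is followed by a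
    bad one are markers: a marker gets colour 2, any other point gets the
    parity of its distance to the next marker.

    Better quasi-order [bqo_finseq].  Given a Borel map f from infinite sets to
    finite sequences, the Galvin-Prikry theorem gives an infinite set A below
    which f is either good everywhere, as wanted, or bad everywhere.  In the
    bad case, B is mapped to y_0 of the bad sequence f(B), f(B minus its
    minimum), ...; as Q is a better quasi-order, for some B the whole sequence
    y is increasing, which is impossible.

    The Galvin-Prikry theorem is proved by Ellentuck's method: the sets that
    can be decided by shrinking, relatively to any finite stem, form a
    sigma-algebra that contains the open sets.  A 3-colouring yields chromatic
    number at most 3 because the cardinalities of the colouring spaces have a
    least element. *)

(** * Borel sets and Borel maps to discrete spaces *)

Section BorelSets.
Context (T : topologicalType).
Implicit Types A B : set T.

Lemma borel_open A : open A -> borel A.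
Proof. exact: (@sub_sigma_algebra T setT open A). Qed.

Lemma borelC A : borel A -> borel (~` A).
Proof. by move=> bA; rewrite -setTD; exact: (sigma_algebraCD bA). Qed.

Lemma borel_bigcup (F : nat -> set T) :
  (forall n, borel (F n)) -> borel (\bigcup_n F n).
Proof. by move=> bF; exact: (sigma_algebra_bigcup bF). Qed.

Lemma borel_bigcap (F : nat -> set T) :
  (forall n, borel (F n)) -> borel (\bigcap_n F n).
Proof.
move=> bF; rewrite -[X in borel X]setCK setC_bigcap.
by apply borelC, borel_bigcup => n; apply borelC.
Qed.

Lemma borelT : borel [set: T].
Proof. apply borel_open; exact: openT. Qed.

Lemma borel0 : borel (@set0 T).
Proof. apply borel_open; exact: open0. Qed.

Lemma borelU A B : borel A -> borel B -> borel (A `|` B).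
Proof.
move=> bA bB; rewrite -bigcup2E; apply borel_bigcup => -[|[|n]] //=.
apply borel0.
Qed.

Lemma borelI A B : borel A -> borel B -> borel (A `&` B).
Proof.
move=> bA bB; rewrite -[A `&` B]setCK setCI.
by apply borelC, borelU; apply borelC.
Qed.

Lemma borel_cst (P : Prop) : borel [set _ : T | P].
Proof.
have [p|np] := pselect P.
  have -> : [set _ : T | P] = setT by apply/seteqP; split.
  exact: borelT.
have -> : [set _ : T | P] = set0 by apply/seteqP; split.
exact: borel0.
Qed.

End BorelSets.

Section DiscretelyValuedBorelMaps.
Context (T : topologicalType).

(** Every subset of a discrete space is Borel, so all preimages are required to
    be; the closure of this class under composition with arbitrary maps is what
    makes it convenient. *)
Record dborel (C : Type) (h : T -> C) : Prop :=
  DBorel { borel_preimage : forall P : set C, borel (h @^-1` P) }.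

Lemma dborel_comp (C D : Type) (g : C -> D) (h : T -> C) :
  dborel h -> dborel (g \o h).
Proof. by move=> bh; split=> P; exact: (borel_preimage bh (g @^-1` P)). Qed.

(** The index is discrete: the preimage splits over its countably many
    values. *)
Lemma dborel_pick (C : Type) (N : T -> nat) (h : nat -> T -> C) :
  dborel N -> (forall n, dborel (h n)) -> dborel (fun x => h (N x) x).
Proof.
move=> bN bh; split=> P.
rewrite (_ : _ @^-1` P =
    \bigcup_n ((N @^-1` [set n]) `&` (h n @^-1` P))); last first.
  by apply/seteqP; split => [x Px|x [n _ [/= <-]]] //; exists (N x).
apply borel_bigcup => n; apply borelI; first by apply (borel_preimage bN).
by apply (borel_preimage (bh n)).
Qed.

Lemma dborel_pair (C D : Type) (g : T -> C) (h : T -> D) :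
  countable [set: C] -> dborel g -> dborel h -> dborel (fun x => (g x, h x)).
Proof.
move=> /pcard_leP/unsquash e bg bh; split=> P.
rewrite (_ : _ @^-1` P = [set x | (fun n x =>
    exists2 c, e c = n & P (c, h x)) (e (g x)) x]); last first.
  apply/seteqP; split => x /= => [Px|[c /inj ecg]]; first by exists (g x).
  by rewrite ecg ?inE.
have b n : dborel (fun x => exists2 c, e c = n & P (c, h x)).
  by apply: (dborel_comp (fun d => exists2 c, e c = n & P (c, d))).
exact: (borel_preimage (dborel_pick (dborel_comp e bg) b) id).
Qed.

Lemma dborel_comp2 (C D E : Type) (k : C -> D -> E) (g : T -> C) (h : T -> D) :
  countable [set: C] -> dborel g -> dborel h -> dborel (fun x => k (g x) (h x)).
Proof.
move=> cC bg bh.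
exact: (dborel_comp (fun p => k p.1 p.2) (dborel_pair cC bg bh)).
Qed.

(** A limit in a discrete space is an eventual value, so the preimage of P is
    the lower limit of the preimages along the sequence. *)
Lemma dborel_lim (C : Type) (h : nat -> T -> C) (l : T -> C) :
  (forall n, dborel (h n)) ->
  (forall x, exists N, forall n, (N <= n)%N -> h n x = l x) -> dborel l.
Proof.
move=> bh hl; split=> P.
rewrite (_ : l @^-1` P = \bigcup_N \bigcap_n (h (N + n)%N @^-1` P)).
  apply borel_bigcup => N; apply borel_bigcap => n.
  by apply (borel_preimage (bh _)).
apply/seteqP; split => x /=; have [N hN] := hl x.
  by move=> Px; exists N => // n _ /=; rewrite hN ?leq_addr.
by move=> [M _ /(_ N I) /=]; rewrite hN ?leq_addl.
Qed.

Lemma dborel_if (C : Type) (A : set T) (g h : T -> C) :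
  borel A -> dborel g -> dborel h ->
  dborel (fun x => if `[< A x >] then g x else h x).
Proof.
move=> bA bg bh; split=> P.
rewrite (_ : _ @^-1` P = (A `&` (g @^-1` P)) `|` (~` A `&` (h @^-1` P))).
  apply borelU; apply borelI => //.
  - by apply (borel_preimage bg).
  - by apply borelC.
  - by apply (borel_preimage bh).
apply/seteqP; split => x /=; first by case: asboolP; [left|right].
by case: asboolP => Ax [[]|[]].
Qed.

Definition first_time (M : nat -> set T) (x : T) : nat :=
  match pselect (exists n, `[< M n x >]) with
  | left h => ex_minn h
  | right _ => 0
  end.

Lemma first_timeP (M : nat -> set T) x : (exists n, M n x) ->
  M (first_time M x) x /\ forall m, (m < first_time M x)%N -> ~ M m x.
Proof.
rewrite /first_time => -[n Mn]; case: pselect => [h|[]]; last first.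
  by exists n; apply/asboolP.
case: ex_minnP => m /asboolP Mm min; split=> // k km Mk.
by have := min k (introT (asboolP _) Mk); rewrite leqNgt km.
Qed.

Lemma first_time_default (M : nat -> set T) x :
  ~ (exists n, M n x) -> first_time M x = 0.
Proof.
rewrite /first_time => nM; case: pselect => // ex; case: nM.
by have [n /asboolP Mn] := ex; exists n.
Qed.

Lemma first_time_eq (M : nat -> set T) x n : M n x ->
  (forall m, (m < n)%N -> ~ M m x) -> first_time M x = n.
Proof.
move=> Mn min; have [|Mf fmin] := @first_timeP M x; first by exists n.
by case: (ltngtP (first_time M x) n) => // [/min|/fmin].
Qed.

Lemma dborel_first_time (M : nat -> set T) :
  (forall n, borel (M n)) -> dborel (first_time M).
Proof.
move=> bM; split=> P.
pose A n := M n `&` \bigcap_m [set x | (m < n)%N -> ~ M m x].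
have bA n : borel (A n).
  apply borelI => //; apply borel_bigcap => m.
  have -> : [set x | (m < n)%N -> ~ M m x] = [set _ | ~ (m < n)%N] `|` ~` M m.
    apply/seteqP; split => x /= => [h|[//|//]].
    by have [mn|] := pselect (m < n)%N; [right; exact: h|left].
  by apply borelU; [exact: borel_cst|apply borelC].
rewrite (_ : _ @^-1` P = \bigcup_n (A n `&` [set _ | P n]) `|`
    (~` (\bigcup_n M n) `&` [set _ | P 0])).
  apply borelU; last first.
    by apply borelI; [by apply borelC, borel_bigcup|apply borel_cst].
  by apply borel_bigcup => n; apply borelI => //; apply borel_cst.
apply/seteqP; split => x /=.
  have [ex|nex] := pselect (exists n, M n x).
    have [Mf min] := first_timeP ex; move=> Pf; left.
    exists (first_time M x) => //.
    by split=> //; split=> // m _; exact: min.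
  rewrite first_time_default// => P0; right; split=> // -[n _ Mn].
  by apply: nex; exists n.
case=> [[n _ [[Mn min] /= Pn]]|[nM P0]].
  by rewrite (@first_time_eq M x n)// => m mn; exact: (min m I mn).
by rewrite first_time_default// => -[n Mn]; apply: nM; exists n.
Qed.

End DiscretelyValuedBorelMaps.

Section DiscreteSequenceSpaces.
Context (C : discreteTopologicalType).
Implicit Types z : nat -> C.

Definition agree n z z' := forall k, (k < n)%N -> z k = z' k.

(** Were there a point outside the open set in every cylinder around z, these
    points would converge to z. *)
Lemma ptws_open_cylinder (O : set {ptws nat -> C}) z :
  open O -> O z -> exists n, forall z', agree n z z' -> O z'.
Proof.
move=> oO Oz; apply: contrapT => nex.
have /choice[u uP] : forall n, exists z', agree n z z' /\ ~ O z'.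
  move=> n; apply: contrapT => h; apply: nex; exists n => z' zz'.
  by apply: contrapT => nO; apply: h; exists z'.
have : (u : nat -> {ptws nat -> C}) @ \oo --> (z : {ptws nat -> C}).
  apply/(@cvg_sup (nat -> C) nat) => i; apply/cvg_image.
    by apply/seteqP; split => // c _; exists (fun=> c).
  move=> P /nbhs_singleton Pzi; exists [set g | P (g i)].
    by exists i.+1 => // n /= ni; have [/(_ i ni) <-] := uP n.
  by apply/seteqP; split => [_ [g /= gi <-]|c Pc] //; exists (fun=> c).
have nO : nbhs (z : {ptws nat -> C}) O by apply: open_nbhs_nbhs; split.
move=> /(_ O nO)[N _ ON].
by have [_] := uP N; apply; exact: (ON N (leqnn N)).
Qed.

Lemma ptws_open_coord i (P : set C) :
  open ([set z | P (z i)] : set {ptws nat -> C}).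
Proof.
have cont : continuous (fun z : {ptws nat -> C} => z i).
  exact: (@proj_continuous nat (fun=> C) i).
exact: (proj1 (continuousP _) cont P (discrete_open P)).
Qed.

Context (A : set {ptws nat -> C}).

Lemma open_subtypeP (U : set (set_type A)) :
  open U <-> forall x, U x -> exists n, forall y,
    agree n (set_val x) (set_val y) -> U y.
Proof.
split=> [[V oV <-] x /= Vx|h].
  by have [n nV] := ptws_open_cylinder oV Vx; exists n => y; exact: nV.
rewrite openE => x /h[n nU].
exists [set y : set_type A | agree n (set_val x) (set_val y)]; split => //.
exists [set z | agree n (set_val x) z] => //.
elim: n {nU} => [|n ih].
  by rewrite (_ : [set z | _] = setT); [exact: openT|apply/seteqP; split].
have := openI ih (ptws_open_coord n (fun c => set_val x n = c)).
congr open; apply/seteqP; split => z /= => [[an en] k|an].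
  by rewrite ltnS leq_eqVlt => /predU1P[->//|]; exact: an.
by split=> [k kn|]; apply: an => //; exact: leqW.
Qed.

Lemma dborel_coord i : dborel (fun x : set_type A => set_val x i).
Proof.
split=> P; apply borel_open; exists [set z : {ptws nat -> C} | P (z i)] => //.
exact: ptws_open_coord.
Qed.

Lemma dborel_prefix (T : topologicalType) (g : T -> nat -> C) n :
  countable [set: C] -> (forall k, dborel (g ^~ k)) ->
  dborel (fun x => mkseq (g x) n).
Proof.
move=> cC bg; elim: n => [|n ih].
  by split=> P; exact: (borel_cst (P [::])).
rewrite (_ : (fun x => _) =
    fun x => (fun c s => rcons s c) (g x n) (mkseq (g x) n)).
  exact: (dborel_comp2 (fun c s => rcons s c) cC (bg n) ih).
by apply/funext => x; rewrite mkseqS.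
Qed.

(** Transfers Borel sets of a subspace of a sequence space along a map g whose
    coordinates are Borel, although g takes its values in the subspace only on
    a part of its domain.  An open set is a countable union of cylinders, and
    membership in a cylinder is a condition on a finite prefix. *)
Lemma borel_subtype_preimage (T : topologicalType) (g : T -> nat -> C)
    (D : set (set_type A)) :
  countable [set: C] -> (forall k, dborel (g ^~ k)) ->
  borel [set x | A (g x)] -> borel D ->
  borel [set x | exists2 w, D w & set_val w = g x].
Proof.
move=> cC bg bA.
have sa : sigma_algebra [set: set_type A]
    [set D | borel [set x | exists2 w, D w & set_val w = g x]].
  split=> /=.
  - rewrite (_ : [set x | _] = set0); first exact: borel0.
    by apply/seteqP; split => x // -[].
  - move=> E bE; have := borelI bA (borelC bE).
    congr borel; apply/seteqP; split => x /=.
      move=> [Ax nE]; exists (exist _ (g x) (mem_set Ax)) => //; split=> // Ew.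
      by apply: nE; exists (exist _ (g x) (mem_set Ax)).
    move=> [w [_ nEw] wg]; split; first by rewrite -wg; exact: set_valP.
    move=> [w' Ew' w'g]; apply: nEw.
    by rewrite -(val_inj (etrans w'g (esym wg))).
  - move=> E bE; have := borel_bigcup bE; congr borel; apply/seteqP.
    split => x [] => [n _ [w Ew wg]|w [n _ Ew] wg].
      by exists w => //; exists n.
    by exists n => //; exists w.
move=> /(_ _ (conj sa _)); apply=> U [V oV <-] /=.
pose Q n := [set s : seq C | forall z, mkseq z n = s -> V z].
have bO : borel (\bigcup_n [set x | Q n (mkseq (g x) n)]).
  apply borel_bigcup => n.
  exact: (borel_preimage (dborel_prefix n cC bg) (Q n)).
have := borelI bA bO; congr borel; apply/seteqP; split => x /=.
  by move=> [Ax [n _ Qn]]; exists (exist _ (g x) (mem_set Ax)) => //; exact: Qn.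
move=> [w Vw wg]; split; first by rewrite -wg; exact: set_valP.
have [n nV] := ptws_open_cylinder oV Vw; exists n => // z zn.
apply: nV => k kn; move: (congr1 (fun s => nth (z 0) s k) zn).
by rewrite !nth_mkseq// wg.
Qed.

End DiscreteSequenceSpaces.

(** * The Galvin-Prikry theorem *)

Lemma infset_lt (B : infset) i j : (i < j)%N -> (set_val B i < set_val B j)%N.
Proof.
have incr : {homo (set_val B : nat -> nat) : i j / (i < j)%N}.
  by apply: homo_ltn; [exact: ltn_trans | exact: (set_valP B)].
exact: incr.
Qed.

Lemma sorted_prefix (B : infset) n : sorted ltn (mkseq (set_val B) n).
Proof.
apply: (homo_sorted (e := ltn)); last exact: iota_ltn_sorted.
by move=> i j; exact: infset_lt.
Qed.

Lemma mkseq_take (f : nat -> nat) m n : (m <= n)%N ->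
  take m (mkseq f n) = mkseq f m.
Proof. by move=> mn; rewrite /mkseq -map_take take_iota (minn_idPl mn). Qed.

Definition unbounded (A : set nat) := forall n, exists2 m, (n <= m)%N & A m.

Lemma unbounded_tail A N :
  unbounded A -> unbounded (A `&` [set m | (N <= m)%N]).
Proof.
move=> uA n; have [m nm Am] := uA (maxn n N).
exists m; first exact: leq_trans (leq_maxl _ _) nm.
by split=> //=; exact: leq_trans (leq_maxr _ _) nm.
Qed.

(** The basic neighbourhoods of the Ellentuck topology; only the elements of A
    above the stem matter, since B increases. *)
Definition cone (s : seq nat) (A : set nat) : set infset :=
  [set B | mkseq (set_val B) (size s) = s /\
           forall k, (size s <= k)%N -> A (set_val B k)].

Definition decides (P : set infset) s A :=
  cone s A `<=` P \/ cone s A `<=` ~` P.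

(** Complete Ramseyness.  Quantifying over all stems, and not just the empty
    one, is what makes the class closed under countable unions. *)
Definition ramsey (P : set infset) := forall s A, unbounded A ->
  exists A', [/\ unbounded A', A' `<=` A & decides P s A'].

Definition below (s : seq nat) m := all (ltn^~ m) s.

Lemma below_eventually s : exists N, forall m, (N <= m)%N -> below s m.
Proof.
exists (\max_(x <- s) x).+1 => m sm; apply/allP => x xs.
by apply: leq_trans sm; rewrite ltnS; exact: (@leq_bigmax_seq _ s xpredT id).
Qed.

Lemma cone_below s A B k :
  cone s A B -> (size s <= k)%N -> below s (set_val B k).
Proof.
move=> [<- _]; rewrite size_mkseq => sk; apply/allP => x /mapP[i].
by rewrite mem_iota /= => /leq_trans/(_ sk) ik ->; exact: infset_lt.
Qed.

Lemma sub_cone s A A' :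
  (forall m, A m -> below s m -> A' m) -> cone s A `<=` cone s A'.
Proof.
move=> AA' B cB; split; first by case: cB.
by move=> k sk; apply: AA'; [case: cB => _; exact|exact: cone_below cB sk].
Qed.

Lemma sub_decides P s A A' :
  (forall m, A m -> below s m -> A' m) -> decides P s A' -> decides P s A.
Proof. by move=> /sub_cone AA' [h|h]; [left|right]; exact: subset_trans h. Qed.

Lemma cone_prefix s A B n : cone s A B -> (size s <= n)%N ->
  cone (mkseq (set_val B) n) A B.
Proof.
move=> [_ BA] sn; split; rewrite size_mkseq// => k nk.
exact/BA/(leq_trans sn).
Qed.

Lemma cone_prefixE s A B n : cone s A B -> (size s <= n)%N ->
  exists t, [/\ mkseq (set_val B) n = s ++ t, size t = (n - size s)%N,
    sorted ltn (s ++ t) & forall x, x \in t -> A x].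
Proof.
move=> [Bs BA] sn; exists (drop (size s) (mkseq (set_val B) n)).
have e : mkseq (set_val B) n = s ++ drop (size s) (mkseq (set_val B) n).
  by rewrite -{1}(cat_take_drop (size s) (mkseq _ n)) mkseq_take// Bs.
split=> //; [by rewrite size_drop size_mkseq|by rewrite -e sorted_prefix|].
move=> x; rewrite /mkseq -map_drop drop_iota => /mapP[k].
by rewrite mem_iota add0n => /andP[sk _] ->; exact: BA.
Qed.

Lemma mem_sorted_below m (t : seq nat) :
  sorted ltn t -> (forall x, x \in t -> (x <= m)%N) ->
  t \in [seq mask b (iota 0 m.+1) | b : m.+1.-tuple bool].
Proof.
move=> st tm; apply/mapP.
pose b := [seq x \in t | x <- iota 0 m.+1].
have sb : size b == m.+1 by rewrite size_map size_iota.
exists (Tuple sb); first by rewrite mem_enum.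
rewrite -filter_mask; apply: (irr_sorted_eq ltn_trans ltnn) => //.
  exact/(sorted_filter ltn_trans)/iota_ltn_sorted.
move=> x; rewrite mem_filter mem_iota /= add0n ltnS.
by case xt : (x \in t) => //=; rewrite tm.
Qed.

(** Fusion (diagonalisation): if D t A can be achieved for each single stem t by
    shrinking A, then one set achieves it for all increasing stems taken from
    it.  The set is built element by element; when a new element m is chosen, the
    reservoir is shrunk so as to serve the finitely many stems with entries at
    most m. *)
Section Fusion.
Variables (D : seq nat -> set nat -> Prop) (A0 : set nat).
Hypothesis D_hereditary : forall t A A',
  (forall m, A m -> below t m -> A' m) -> D t A' -> D t A.
Hypothesis D_dense : forall t A, unbounded A -> A `<=` A0 ->
  exists A', [/\ unbounded A', A' `<=` A & D t A'].

Lemma dense_list (L : seq (seq nat)) A : unbounded A -> A `<=` A0 ->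
  exists A', [/\ unbounded A', A' `<=` A & forall t, t \in L -> D t A'].
Proof.
move=> uA AA0; elim: L => [|t L [A1 [u1 A1A DL]]]; first by exists A; split.
have [A2 [u2 A2A1 Dt]] := D_dense t u1 (subset_trans A1A AA0).
exists A2; split=> //; first exact: subset_trans A1A.
move=> r; rewrite inE => /predU1P[->//|/DL].
by apply: D_hereditary => m /A2A1.
Qed.

Lemma fusion : unbounded A0 -> exists A, [/\ unbounded A, A `<=` A0 &
  forall t, sorted ltn t -> (forall x, x \in t -> A x) -> D t A].
Proof.
move=> u0; pose state := {A : set nat | unbounded A /\ A `<=` A0}.
have step (S : state) : exists p : nat * state, [/\ sval S p.1,
    forall x, sval p.2 x -> sval S x /\ (p.1 < x)%N &
    forall t, sorted ltn t -> (forall x, x \in t -> (x <= p.1)%N) ->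
      D t (sval p.2)].
  case: S => S [uS SA0] /=; have [m _ Sm] := uS 0%N.
  have uS' : unbounded (S `&` [set x | (m < x)%N]) by exact: unbounded_tail.
  have S'A0 : S `&` [set x | (m < x)%N] `<=` A0 by move=> x [/SA0].
  have [A' [uA' A'S DA']] :=
    dense_list [seq mask b (iota 0 m.+1) | b : m.+1.-tuple bool] uS' S'A0.
  have A'A0 : A' `<=` A0 by exact: subset_trans S'A0.
  exists (m, exist _ A' (conj uA' A'A0)); split=> //= t st tm.
  exact/DA'/mem_sorted_below.
have [f fP] := choice step.
have [A1 [u1 A10 D1]] := D_dense [::] u0 (fun x => id).
pose S0 : state := exist _ A1 (conj u1 A10).
pose S n := iter n (fun X => (f X).2) S0.
pose a n := (f (S n)).1.
have Sdec n k x : sval (S (n + k)%N) x -> sval (S n) x.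
  elim: k => [|k ih]; first by rewrite addn0.
  by rewrite addnS => Sx; apply: ih; have [_ /(_ x Sx)[]] := fP (S (n + k)%N).
have aS n : sval (S n) (a n) by have [] := fP (S n).
have Sa n k : (n < k)%N -> sval (S n.+1) (a k).
  by move=> nk; apply: (Sdec n.+1 (k - n.+1)%N); rewrite subnKC.
have a_lt n k : (n < k)%N -> (a n < a k)%N.
  by move=> /Sa Sk; have [_ /(_ _ Sk)[]] := fP (S n).
exists (range a); split.
- move=> n; exists (a n); last by exists n.
  by elim: n => // n ih; apply: leq_ltn_trans ih (a_lt _ _ (leqnn _)).
- by move=> _ [n _ <-]; exact: (proj2 (svalP (S n))).
move=> t st tA; case: (lastP t) st tA => [|{}t x] st tA.
  apply: D_hereditary D1 => _ [n _ <-] _; exact: (Sdec 0%N n).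
have [n _ an] : range a x by apply: tA; rewrite mem_rcons inE eqxx.
have tx : below t x.
  by move: st; rewrite (sorted_pairwise ltn_trans) pairwise_rcons => /andP[].
have [_ _ /(_ (rcons t x) st)] := fP (S n); rewrite -/(a n) an => Dt.
apply: (D_hereditary (A' := sval (S n.+1))) => [_ [k _ <-]|]; last first.
  apply: Dt => y; rewrite mem_rcons inE => /predU1P[->//|yt].
  exact/ltnW/(allP tx).
rewrite /below all_rcons -an => /andP[/= ank _]; apply: Sa.
case: (ltngtP n k) => // [/a_lt/ltnW kn|kn]; first by rewrite ltnNge kn in ank.
by rewrite kn ltnn in ank.
Qed.

End Fusion.

Definition bar (F : set (seq nat)) : set infset :=
  [set B | exists n, F (mkseq (set_val B) n)].

(** Galvin's lemma.  The set A accepts a stem u when the cone of u in A lies in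
    the bar, and rejects it when no infinite subset does.  A first fusion makes
    every stem accepted or rejected.  If s is rejected, a rejected stem has
    only finitely many accepted one-point extensions, since infinitely many of
    them would make up a set that accepts the stem; so a second fusion makes
    rejection hereditary, and then no member of the cone of s is in the bar. *)
Lemma ramsey_bar (F : set (seq nat)) : ramsey (bar F).
Proof.
move=> s A uA.
pose acc A u := cone u A `<=` bar F.
pose rej A u := forall A', unbounded A' -> A' `<=` A -> ~ acc A' u.
have accS A1 A2 u :
    (forall m, A1 m -> below u m -> A2 m) -> acc A2 u -> acc A1 u.
  by move=> /sub_cone A12; exact: subset_trans.
have below_cat u t m : below (u ++ t) m -> below t m.
  by rewrite /below all_cat => /andP[].
(* First fusion: every stem from A1 is accepted or rejected. *)
have [t A1 A2 A12 [a2|r2]|t A1 u1 A1A|A1 [u1 A1A D1]] :=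
    @fusion (fun t A => acc A (s ++ t) \/ rej A (s ++ t)) A _ _ uA.
- by left; apply: accS a2 => m /A12 h /below_cat.
- right=> A' uA' A'A1 acc'; have [N sN] := below_eventually (s ++ t).
  apply: (r2 (A' `&` [set m | (N <= m)%N])); first exact: unbounded_tail.
    by move=> m [/A'A1 A1m /sN/below_cat]; exact: A12.
  by apply: accS acc' => m [].
- have [r|nr] := pselect (rej A1 (s ++ t)).
    by exists A1; split => //; right.
  move/existsNP: nr => [A2 /not_implyP[u2 /not_implyP[A21 /contrapT a2]]].
  by exists A2; split => //; left.
have [a1|r1] : acc A1 s \/ rej A1 s by have := D1 [::]; rewrite cats0; apply.
  by exists A1; split => //; left.
(* Second fusion: one-point extensions of rejected stems are rejected. *)
pose D2 t A2 :=
  sorted ltn t -> (forall x, x \in t -> A1 x) -> rej A1 (s ++ t) ->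
  forall m, A2 m -> below (s ++ t) m -> rej A1 (rcons (s ++ t) m).
have [t A2 A3 A23 D23 st tA1 r m A2m sm|t A2 u2 A21|A2 [u2 A21 D2A]] :=
    @fusion D2 A1 _ _ u1.
- by apply: D23 => //; apply: A23 => //; exact: below_cat sm.
- have [[st [tA1 r]]|ng] := pselect (sorted ltn t /\
      (forall x, x \in t -> A1 x) /\ rej A1 (s ++ t)); last first.
    by exists A2; split=> // st tA1 r; case: ng.
  (* Infinitely many accepted extensions would make M accept s ++ t. *)
  pose M := [set m | A2 m /\ (below (s ++ t) m /\ ~ rej A1 (rcons (s ++ t) m))].
  have [uM|bM] := pselect (unbounded M).
    exfalso; apply: (r M uM) => [m [/A21]//|B cB].
    have [A2n [sn nr]] : M (set_val B (size (s ++ t))) by case: cB => _; exact.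
    have cB' : cone (rcons (s ++ t) (set_val B (size (s ++ t)))) A1 B.
      rewrite -{1}(proj1 cB) -mkseqS.
      by apply: cone_prefix (leqnSn _); apply: sub_cone cB => m [/A21].
    have tA1' x : x \in rcons t (set_val B (size (s ++ t))) -> A1 x.
      by rewrite mem_rcons inE => /predU1P[->|/tA1//]; exact: A21.
    have st' : sorted ltn (rcons t (set_val B (size (s ++ t)))).
      rewrite (sorted_pairwise ltn_trans) pairwise_rcons.
      rewrite -(sorted_pairwise ltn_trans) st andbT.
      exact: below_cat sn.
    by have := D1 _ st' tA1'; rewrite -rcons_cat => -[|//]; apply.
  move/existsNP: bM => [N bM].
  exists (A2 `&` [set m | (N <= m)%N]); split; first exact: unbounded_tail.
  + by move=> m [].
  move=> _ _ _ m [A2m /= Nm] sm; apply: contrapT => nr; apply: bM.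
  by exists m.
have rejA2 t : sorted ltn (s ++ t) ->
    (forall x, x \in t -> A2 x) -> rej A1 (s ++ t).
  elim/last_ind: t => [|t m ih]; first by rewrite cats0.
  rewrite -rcons_cat => + tA2.
  rewrite (sorted_pairwise ltn_trans) pairwise_rcons.
  rewrite -(sorted_pairwise ltn_trans).
  move=> /andP[sm sst]; have st := (cat_sorted2 sst).2; apply: D2A => //.
  - by move=> x xt; apply: tA2; rewrite mem_rcons inE xt orbT.
  - by move=> x xt; apply/A21/tA2; rewrite mem_rcons inE xt orbT.
  - by apply: ih => // x xt; apply: tA2; rewrite mem_rcons inE xt orbT.
  - by apply: tA2; rewrite mem_rcons inE eqxx.
exists A2; split=> //; first exact: subset_trans A1A.
right=> B cB [n Fn].
have [sn|/ltnW ns] := leqP (size s) n.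
  have [t [Bn _ st tA2]] := cone_prefixE cB sn.
  apply: (rejA2 t st tA2 A1 u1 (fun x => id)) => B' [B't _].
  by exists (size (s ++ t)); rewrite B't -Bn.
apply: (r1 A1 u1 (fun x => id)) => B' [B's _]; exists n.
by rewrite -(mkseq_take _ ns) B's -(proj1 cB) mkseq_take.
Qed.

Lemma ramseyC P : ramsey P -> ramsey (~` P).
Proof.
move=> rP s A /(rP s)[A' [uA' A'A [d|d]]]; exists A'; split=> //; last by left.
by right; rewrite setCK.
Qed.

(** After a fusion, P_0, ..., P_n are decided by every extension of the stem by
    n elements, so that on the cone at hand the union coincides with an open
    set. *)
Lemma ramsey_bigcup (P : nat -> set infset) :
  (forall n, ramsey (P n)) -> ramsey (\bigcup_n P n).
Proof.
move=> rP s A uA.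
have [t A1 A2 A12 D2 n nt|t A1 u1 A1A|A1 [u1 A1A D1]] := @fusion
    (fun t A => forall n, (n <= size t)%N -> decides (P n) (s ++ t) A) A _ _ uA.
- apply: sub_decides (D2 n nt) => m A1m.
  by rewrite /below all_cat => /andP[_]; exact: A12.
- elim: (size t) => [|k [A2 [u2 A21 dk]]].
    have [A2 [u2 A21 d]] := rP 0%N (s ++ t) A1 u1.
    by exists A2; split=> // n; rewrite leqn0 => /eqP->.
  have [A3 [u3 A32 d]] := rP k.+1 (s ++ t) A2 u2.
  exists A3; split=> //; first exact: subset_trans A21.
  move=> n; rewrite leq_eqVlt ltnS => /predU1P[->//|/dk].
  by apply: sub_decides => m /A32.
(* On the cone of s in A1 the union agrees with the bar of F; the size condition
   is there because the cone in A1 of a proper prefix of s need not contain that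
   of s. *)
pose F u := (size s <= size u)%N /\ exists n, cone u A1 `<=` P n.
have [A2 [u2 A21 d]] := @ramsey_bar F s A1 u1.
exists A2; split=> //; first exact: subset_trans A1A.
have barE B : cone s A2 B -> bar F B <-> (\bigcup_n P n) B.
  move=> cB2; have cB : cone s A1 B by apply: sub_cone cB2 => m /A21.
  split=> [[m []]|[n _ Pn]].
    rewrite size_mkseq => sm [n cP]; exists n => //.
    exact/cP/(cone_prefix cB).
  have sn : (size s <= size s + n)%N by exact: leq_addr.
  have [t [Bt st srt tA1]] := cone_prefixE cB sn.
  exists (size s + n)%N; split; first by rewrite size_mkseq.
  exists n; have := D1 t; rewrite -Bt => /(_ _ tA1 n)[].
  - exact: (cat_sorted2 srt).2.
  - by rewrite st addKn.
  - by [].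
  - by move=> /(_ B (cone_prefix cB sn)).
case: d => d; [left|right] => B cB; first exact/(barE B cB)/d.
by move=> /(barE B cB)/d; exact.
Qed.

Lemma ramsey_open (U : set infset) : open U -> ramsey U.
Proof.
move=> /open_subtypeP oU.
rewrite (_ : U = bar [set u | forall B : infset,
    mkseq (set_val B) (size u) = u -> U B]); first exact: ramsey_bar.
apply/seteqP; split => [B /oU[n nU]|B [n /=]]; last first.
  by rewrite size_mkseq; apply.
exists n => B' /=; rewrite size_mkseq => B'B; apply: nU => k kn.
by have := congr1 (nth 0%N ^~ k) B'B; rewrite /= !nth_mkseq.
Qed.

Lemma borel_ramsey (P : set infset) : borel P -> ramsey P.
Proof.
move=> bP; apply: (bP [set P | ramsey P]); split; last by move=> U /ramsey_open.
split=> /= [|A rA|F rF].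
- exact/ramsey_open/open0.
- by rewrite setTD; exact: ramseyC.
- exact: ramsey_bigcup.
Qed.

Lemma unbounded_infset A :
  unbounded A -> exists B : infset, set_of_infset B `<=` A.
Proof.
move=> uA; have /choice[f fP] : forall n, exists m, (n <= m)%N /\ A m.
  by move=> n; have [m nm Am] := uA n; exists m.
pose b n := iter n (fun x => f x.+1) (f 0%N).
have bP : b \in strictly_increasing.
  by apply/mem_set => k; have [] := fP (b k).+1.
exists (exist _ b bP) => _ [[|n] _ <-]; first by have [] := fP 0%N.
by have [] := fP (b n).+1.
Qed.

Theorem galvin_prikry (P : set infset) : borel P -> exists A : infset,
  (forall B : infset, set_of_infset B `<=` set_of_infset A -> P B) \/
  (forall B : infset, set_of_infset B `<=` set_of_infset A -> ~ P B).
Proof.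
move=> /borel_ramsey/(_ [::] setT)[n|A [uA _ d]]; first by exists n.
have [A' A'A] := unbounded_infset uA; exists A'.
have cA' (B : infset) : set_of_infset B `<=` set_of_infset A' -> cone [::] A B.
  by move=> BA'; split=> // k _; apply/A'A/BA'; exists k.
by case: d => d; [left|right] => B /cA'/d.
Qed.

(** * The leading sequence of a bad sequence of finite sequences *)

Lemma iter_shift (T : Type) (X : nat -> T) k i :
  iter k (@shift _) X i = X (i + k)%N.
Proof. by elim: k i => [|k ih] i; rewrite ?addn0// iterS /shift ih addSnnS. Qed.

Lemma nonincreasing_stabilizes (u : nat -> nat) : (forall n, u n.+1 <= u n)%N ->
  exists N, forall n, (N <= n)%N -> u n = u N.
Proof.
move=> uS.
have ex : exists v, `[< exists n, u n = v >].
  by exists (u 0%N); apply/asboolP; exists 0%N.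
case: (ex_minnP ex) => v /asboolP[N uN] min; exists N => n Nn.
apply/eqP; rewrite eqn_leq uN min ?andbT; last by apply/asboolP; exists n.
rewrite -uN -(subnKC Nn); elim: (n - N)%N => [|k ih]; first by rewrite addn0.
by rewrite addnS (leq_trans (uS _)).
Qed.

Lemma countable_finseq (Q : choiceType) :
  countable [set: Q] -> countable [set: finseq Q].
Proof.
move=> /countable_injP[e /in2TT einj]; apply/countable_injP.
exists (fun t : finseq Q => pickle [seq e (tagged t i) | i : 'I_(tag t).+1]).
move=> [n f] [m g] _ _ /(pcan_inj pickleK) fg.
have nm : n = m.
  by move: (congr1 size fg); rewrite /= !size_image !card_ord => -[].
subst m; congr existT; apply/ffunP => i; apply: einj.
by move/eq_in_map: fg; apply; rewrite mem_enum.
Qed.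

Section LeadingEntry.
Context (d : Order.disp_t) (Q : preorderType d).
Implicit Types (s t : finseq Q) (X : nat -> finseq Q).

Definition entry t i : Q := tagged t (inord i).

(** The Higman order between the tail of s from a and the tail of t from b, with
    positions kept absolute. *)
Definition tail_embeds s a t b := exists h : nat -> nat,
  (forall i j, (a <= i)%N -> (i < j)%N -> (j <= tag s)%N -> (h i < h j)%N) /\
  (forall i, (a <= i)%N -> (i <= tag s)%N ->
     [/\ (b <= h i)%N, (h i <= tag t)%N & (entry s i <= entry t (h i))%O]).

Lemma sub_tail_embeds s a a' t b b' : (a <= a')%N -> (b' <= b)%N ->
  tail_embeds s a t b -> tail_embeds s a' t b'.
Proof.
move=> aa' b'b [h [hlt hP]]; exists h; split=> [i j a'i|i a'i si].
  by apply: hlt; exact: leq_trans aa' a'i.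
have [bh ht le] := hP i (leq_trans aa' a'i) si.
by split=> //; exact: leq_trans bh.
Qed.

Lemma tail_embeds_nil s a t b : (tag s < a)%N -> tail_embeds s a t b.
Proof.
move=> sa; exists id; split=> // i ai si.
by have := leq_trans (leq_trans sa ai) si; rewrite ltnn.
Qed.

(** Read backwards: a failed embedding whose first entries are comparable stays
    failed when both first entries are deleted. *)
Lemma tail_embeds_cons s a t b : (b <= tag t)%N -> (entry s a <= entry t b)%O ->
  tail_embeds s a.+1 t b.+1 -> tail_embeds s a t b.
Proof.
move=> bt le [h [hlt hP]]; exists (fun i => if i == a then b else h i).
split=> [i j ai ij js|i ai si].
  have aj : (a < j)%N by exact: leq_ltn_trans ai ij.
  rewrite (gtn_eqF aj); case: eqVneq => [_|ia].
    by have [] := hP j aj js.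
  by apply: hlt => //; rewrite ltn_neqAle eq_sym ia.
case: eqVneq => [->//|ia].
have [|bh ht le'] := hP i _ si; first by rewrite ltn_neqAle eq_sym ia.
by split=> //; exact: ltnW.
Qed.

Lemma tail_embeds_higman s t : tail_embeds s 0 t 0 -> (s <= t)%O.
Proof.
move=> [h [hlt hP]]; apply/asboolP.
have hb (i : 'I_(tag s).+1) : (h i < (tag t).+1)%N.
  by have [_ + _] := hP i (leq0n _) (ltn_ord i).
exists (fun i => Ordinal (hb i)); split=> [i j ij|i] /=.
  exact: hlt (ltn_ord j).
have [_ _] := hP i (leq0n _) (ltn_ord i); rewrite /entry inord_val.
by congr (_ <= tagged t _)%O; apply: val_inj; rewrite /= inordK// hb.
Qed.

(** The greatest start in s from which no embedding in the tail of t from b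
    exists; 0 when every tail embeds. *)
Definition max_bad s t b : nat :=
  \max_(a < (tag s).+1 | ~~ `[< tail_embeds s a t b >]) a.

Lemma max_bad_tag s t b : (max_bad s t b <= tag s)%N.
Proof. by apply/bigmax_leqP => a _; rewrite -ltnS ltn_ord. Qed.

Lemma leq_max_bad s a t b : ~ tail_embeds s a t b -> (a <= max_bad s t b)%N.
Proof.
move=> nE; have sa : (a < (tag s).+1)%N.
  by rewrite ltnS leqNgt; apply/negP => /tail_embeds_nil/nE.
by apply: (leq_bigmax_cond (Ordinal sa)); apply/asboolPn.
Qed.

Lemma max_badP s a t b :
  ~ tail_embeds s a t b -> ~ tail_embeds s (max_bad s t b) t b.
Proof.
move=> nE; have sa : (a < (tag s).+1)%N.
  by rewrite ltnS leqNgt; apply/negP => /tail_embeds_nil/nE.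
have card_gt0 :
    (0 < #|[pred i : 'I_(tag s).+1 | ~~ `[< tail_embeds s i t b >]]|)%N.
  by apply/card_gt0P; exists (Ordinal sa); rewrite inE; apply/asboolPn.
have [i + e] := eq_bigmax_cond (@nat_of_ord (tag s).+1) card_gt0.
by rewrite inE -/(max_bad s t b) => /asboolPn; rewrite /max_bad -e.
Qed.

Lemma max_bad_mono s t : {homo max_bad s t : b b' / (b <= b')%N}.
Proof.
move=> b b' bb'; apply/bigmax_leqP => a /asboolPn nE; apply: leq_max_bad.
by apply: contra_not nE; exact: sub_tail_embeds.
Qed.

(** For a bad sequence, the greatest first value of a family of starting points
    subject only to the constraints between X_0, ..., X_n. *)
Fixpoint chain_max n X : nat :=
  if n is n'.+1 then max_bad (X 0) (X 1) (chain_max n' (shift X))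
  else tag (X 0).

Lemma chain_max_dec n X : (chain_max n.+1 X <= chain_max n X)%N.
Proof.
elim: n X => [|n ih] X; first exact: max_bad_tag.
exact/max_bad_mono/ih.
Qed.

(** The eventual value of chain_max; for a bad sequence it is the first value of
    the greatest family of starting points. *)
Definition best_start X := chain_max (xget 0
  [set N | forall n, (N <= n)%N -> chain_max n X = chain_max N X]) X.

Lemma chain_max_best X :
  exists N, forall n, (N <= n)%N -> chain_max n X = best_start X.
Proof.
have [N NP] := nonincreasing_stabilizes (chain_max_dec ^~ X).
rewrite /best_start; case: xgetP => [M _ MP|/(_ N)//]; by exists M.
Qed.

Lemma best_startE X : best_start X = max_bad (X 0) (X 1) (best_start (shift X)).
Proof.
have [N maxX] := chain_max_best X; have [M maxSX] := chain_max_best (shift X).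
rewrite -(maxX (maxn N M).+1) ?leqW ?leq_maxl//=.
by rewrite maxSX ?leq_maxr.
Qed.

Definition bad_starts X a :=
  forall k, ~ tail_embeds (X k) (a k) (X k.+1) (a k.+1).

(** By monotonicity of max_bad, a bound on the starts along the shifted sequence
    yields one at the first position. *)
Lemma bad_starts_le X a : bad_starts X a -> (a 0 <= best_start X)%N.
Proof.
move=> bad; have [N /(_ N (leqnn N)) <-] := chain_max_best X.
elim: N X a bad => [|n ih] X a bad.
  by rewrite leqNgt; apply/negP => lt; exact/(bad 0)/tail_embeds_nil.
have := ih (shift X) (shift a) (fun k => bad k.+1).
move=> /(max_bad_mono (X 0) (X 1)); apply: leq_trans.
by apply: leq_max_bad; exact: (bad 0).
Qed.

Lemma bad_best_start X : ~ (X 0 <= X 1)%O ->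
  ~ tail_embeds (X 0) (best_start X) (X 1) (best_start (shift X)).
Proof.
move=> nle; rewrite best_startE; apply: (@max_badP _ 0).
apply: contra_not nle => /(sub_tail_embeds (leqnn 0) (leq0n _)).
exact: tail_embeds_higman.
Qed.

Definition lead X : Q := entry (X 0) (best_start X).

(** If the leading entries increased from N on, adding 1 to the greatest family
    from N on would give a greater one. *)
Lemma lead_infinitely_bad X : (forall k, ~ (X k <= X k.+1)%O) ->
  forall N, exists2 k, (N <= k)%N &
    ~ (lead (iter k (@shift _) X) <= lead (iter k.+1 (@shift _) X))%O.
Proof.
move=> badX N; apply: contrapT => good.
pose a k := best_start (iter k (@shift _) (iter N (@shift _) X)).
(* The family is raised along the sequence shifted by N, so that no case
   distinction on the position is needed. *)
suff /bad_starts_le : bad_starts (iter N (@shift _) X) (fun k => (a k).+1).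
  by rewrite ltnn.
have bad k : ~ tail_embeds (X (k + N)) (a k) (X (k.+1 + N)) (a k.+1).
  have := @bad_best_start (iter (k + N) (@shift _) X).
  by rewrite !iter_shift add0n add1n iterD => /(_ (badX _)).
move=> k; rewrite !iter_shift; apply: contra_not (bad k).
apply: tail_embeds_cons.
  by rewrite leqNgt; apply/negP => lt; exact/(bad k.+1)/tail_embeds_nil.
apply: contrapT => nle; apply: good; exists (k + N)%N; first exact: leq_addl.
by rewrite /lead !iter_shift -addSn !iterD.
Qed.

Hypothesis cQ : countable [set: Q].

Lemma dborel_chain_max (T : topologicalType) n (X : T -> nat -> finseq Q) :
  (forall k, dborel (X ^~ k)) -> dborel (fun x => chain_max n (X x)).
Proof.
elim: n X => [|n ih] X bX; first exact: (dborel_comp _ (bX 0)).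
have cF := countable_finseq cQ.
have bS := ih (fun x => shift (X x)) (fun k => bX k.+1).
have := dborel_pair cF (bX 0) (dborel_pair cF (bX 1) bS).
exact: (dborel_comp (fun p => max_bad p.1 p.2.1 p.2.2)).
Qed.

(** Each chain_max n depends on finitely many coordinates, and best_start is
    their limit. *)
Lemma dborel_lead (T : topologicalType) (X : T -> nat -> finseq Q) :
  (forall k, dborel (X ^~ k)) -> dborel (fun x => lead (X x)).
Proof.
move=> bX; apply: (dborel_comp2 entry (countable_finseq cQ) (bX 0)).
apply: (dborel_lim (h := fun n x => chain_max n (X x))) => [n|x].
  exact: dborel_chain_max.
exact: chain_max_best.
Qed.

End LeadingEntry.

(** * Finite sequences over a better quasi-order *)

Lemma borel_preimage_continuous (S T : topologicalType) (g : S -> T)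
    (B : set T) :
  continuous g -> borel B -> borel (g @^-1` B).
Proof.
move=> /continuousP cg bB; apply: (bB [set B | borel (g @^-1` B)]).
split=> [|U oU]; last by apply borel_open; exact: cg.
split=> [|A bA|F bF] /=.
- by rewrite preimage_set0; exact: borel0.
- by rewrite setTD preimage_setC; apply borelC.
- by rewrite preimage_bigcup; apply borel_bigcup.
Qed.

Lemma dborel_continuous (S T : topologicalType) (C : Type) (g : S -> T)
    (h : T -> C) :
  continuous g -> dborel h -> dborel (h \o g).
Proof.
move=> cg bh; split=> P.
exact: (borel_preimage_continuous cg (borel_preimage bh P)).
Qed.

Lemma continuous_infset (g : infset -> infset) :
  (forall n, exists m, forall B B' : infset, agree m (set_val B) (set_val B') ->
     agree n (set_val (g B)) (set_val (g B'))) -> continuous g.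
Proof.
move=> gP; apply/continuousP => U /open_subtypeP oU.
apply/open_subtypeP => B /oU[n nU].
by have [m mn] := gP n; exists m => B' /mn/nU.
Qed.

Lemma remove_min_continuous : continuous remove_min.
Proof.
apply: continuous_infset => n; exists n.+1 => B B' BB' k kn; exact: BB'.
Qed.

Lemma iter_remove_min_continuous k : continuous (iter k remove_min).
Proof.
elim: k => [|k ih]; first by move=> x; exact: cvg_id.
by move=> B; apply: continuous_comp; [exact: ih|exact: remove_min_continuous].
Qed.

Lemma comp_strictly_increasing (A B : infset) :
  (set_val A \o set_val B : nat -> nat) \in strictly_increasing.
Proof. by apply/mem_set => k; apply/infset_lt/infset_lt. Qed.

Definition comp_infset (A B : infset) : infset :=
  exist _ (set_val A \o set_val B) (comp_strictly_increasing A B).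

Lemma comp_infset_continuous A : continuous (comp_infset A).
Proof.
apply: continuous_infset => n; exists n => B B' BB' k kn.
exact: (congr1 (set_val A) (BB' k kn)).
Qed.

Lemma iter_remove_minE k B i :
  set_val (iter k remove_min B) i = set_val B (i + k)%N.
Proof. by elim: k i => [|k ih] i; rewrite ?addn0//= -addSnnS -ih. Qed.

(** Higman's theorem for better quasi-orders. *)
Lemma bqo_finseq (d : Order.disp_t) (Q : preorderType d) :
  countable [set: Q] -> bqo Q -> bqo (finseq Q).
Proof.
move=> cQ bqoQ f bf.
have cF := countable_finseq cQ.
have {}bf : dborel (f : infset -> finseq Q).
  split=> P; apply: bf; apply borel_open.
  exact: (@discrete_open (discrete_topology (finseq Q))).
have bP : borel [set B | ((f B : finseq Q) <= f (remove_min B))%O].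
  exact: (borel_preimage (dborel_comp2 (fun s t => (s <= t)%O) cF bf
    (dborel_continuous remove_min_continuous bf)) [set b | b]).
have [A [good|bad]] := galvin_prikry bP; first by exists A.
exfalso.
pose X B k : finseq Q := f (comp_infset A (iter k remove_min B)).
have bX k : dborel (X ^~ k).
  have := dborel_continuous (@comp_infset_continuous A) bf.
  by move/(dborel_continuous (@iter_remove_min_continuous k)).
have [|A' A'P] := bqoQ (fun B => lead (X B)).
  by move=> D _; exact: (borel_preimage (dborel_lead cQ bX) D).
have shX B : shift (X B) = X (remove_min B).
  by apply/funext => k; rewrite /shift /X iterSr.
have itX k : iter k (@shift _) (X A') = X (iter k remove_min A').
  by elim: k => // k ih; rewrite !iterS ih shX.
have badX k : ~ (X A' k <= X A' k.+1)%O.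
  have -> : X A' k.+1 = f (remove_min (comp_infset A (iter k remove_min A'))).
    by congr f; apply: val_inj.
  by apply: bad => _ [i _ <-]; exists (set_val (iter k remove_min A') i).
have [k _] := lead_infinitely_bad badX 0; apply.
rewrite !itX iterS; apply: A'P => _ [i _ <-].
by rewrite iter_remove_minE; exists (i + k)%N.
Qed.

(** * Colouring bad sequences of finite sequences *)

Section Colouring.

(** A bad sequence differs from its shift, so these are the Borel 3-colourings
    of the graph of bad sequences, with a concrete set of colours. *)
Definition shift_colorable (d : Order.disp_t) (Q : preorderType d) :=
  exists c : bad_seq Q -> 'I_3, dborel c /\
    forall z z', shift (set_val z) = set_val z' -> c z <> c z'.

Context (d : Order.disp_t) (Q : preorderType d) (cQ : countable [set: Q]).

Section Extension.
Variable c : bad_seq Q -> 'I_3.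

(** Total extension of a colouring to all sequences, with a junk value at those
    that are not bad. *)
Definition extend (z : nat -> Q) : 'I_3 :=
  match pselect (bad_seq_set z) with
  | left h => c (exist _ z (mem_set h))
  | right _ => ord0
  end.

Lemma extendE (z : bad_seq Q) : extend (set_val z) = c z.
Proof.
rewrite /extend; case: pselect => [h|[]]; last exact: (set_valP z).
by congr c; apply: val_inj.
Qed.

Lemma extend_neq (z : nat -> Q) :
  (forall w w', shift (set_val w) = set_val w' -> c w <> c w') ->
  bad_seq_set z -> extend z <> extend (shift z).
Proof.
move=> cP bz; have bsz : bad_seq_set (shift z) by move=> k; exact: (bz k.+1).
pose w : bad_seq Q := exist _ z (mem_set bz).
pose w' : bad_seq Q := exist _ (shift z) (mem_set bsz).
rewrite -[z]/(set_val w) -[shift _]/(set_val w') !extendE.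
exact: cP.
Qed.

Lemma dborel_extend (T : topologicalType) (g : T -> nat -> Q) :
  dborel c -> (forall k, dborel (g ^~ k)) -> dborel (fun x => extend (g x)).
Proof.
move=> bc bg; split=> P.
have bb : borel [set x | @bad_seq_set _ Q (g x)].
  have := borel_bigcap (fun k => borel_preimage
    (dborel_comp2 (fun p q => ~~ (p <= q)%O) cQ (bg k) (bg k.+1)) [set b | b]).
  congr borel; apply/seteqP; split => x /= h k; first exact: (h k I).
  by move=> _; exact: h.
have bC := borel_subtype_preimage (C := discrete_topology Q)
  cQ bg bb (borel_preimage bc P).
have := borelU bC (borelI (borelC bb) (borel_cst (P ord0))).
congr borel; apply/seteqP; split => x /=.
  move=> [[w Pw <-]|[nb P0]]; first by rewrite extendE.
  by rewrite /extend; case: pselect.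
rewrite /extend; case: pselect => [h Pc|nb P0]; last by right.
by left; exists (exist _ (g x) (mem_set h)).
Qed.
End Extension.

Lemma shift_colorable_finseq : shift_colorable Q -> shift_colorable (finseq Q).
Proof.
move=> [c [bc cP]].
have rot (i : 'I_3) : ordS i <> i by case: i => -[|[|[|]]].
pose Y (x : bad_seq (finseq Q)) k := lead (iter k (@shift _) (set_val x)).
have bY k : dborel (Y ^~ k).
  apply: dborel_lead => // i.
  rewrite (_ : (fun x => _) = fun x => set_val x (i + k)%N).
    exact: (@dborel_coord (discrete_topology (finseq Q)) _ (i + k)).
  by apply/funext => x; rewrite iter_shift.
pose b x k := ~ (Y x k <= Y x k.+1)%O.
have bb k : borel [set x | b x k].
  exact: (borel_preimage
    (dborel_comp2 (fun p q => (p <= q)%O) cQ (bY k) (bY k.+1)) [set t | ~ t]).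
pose tail n := [set x | forall k, (n <= k)%N -> b x k].
have btail n : borel (tail n).
  have := borel_bigcap (fun k => bb (n + k)%N); congr borel.
  apply/seteqP; split => x /= h k; last by move=> _; apply: h; exact: leq_addr.
  by move=> nk; rewrite -(subnKC nk); apply: h.
pose mark n := [set x | ~ b x n /\ b x n.+1].
have bmark n : borel (mark n) by exact: (borelI (borelC (bb n)) (bb n.+1)).
pose colB x := iter (first_time tail x) (@ordS 3)
  (extend c (fun k => Y x (k + first_time tail x)%N)).
pose colA x : 'I_3 :=
  if first_time mark x == 0%N then inord 2 else inord (odd (first_time mark x)).
have bB : dborel colB.
  apply: (dborel_pick (h := fun n x =>
    iter n (@ordS 3) (extend c (fun k => Y x (k + n)%N)))).
    exact: dborel_first_time.
  move=> n; apply: (dborel_comp (iter n (@ordS 3))).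
  by apply: dborel_extend => // k; exact: bY.
have bA : dborel colA.
  exact: (dborel_comp (fun n => if n == 0%N then inord 2 else inord (odd n))
    (dborel_first_time bmark)).
exists (fun x => if `[< (\bigcup_n tail n) x >] then colB x else colA x); split.
  by apply: dborel_if => //; apply borel_bigcup.
move=> x y xy.
have Yxy k : Y y k = Y x k.+1 by rewrite /Y -xy -iterSr.
have bxy k : b y k = b x k.+1 by rewrite /b !Yxy.
have tailxy : (\bigcup_n tail n) x = (\bigcup_n tail n) y.
  apply/propext; split => -[n _ tn].
    by exists n => // k nk; rewrite bxy; apply: tn; exact: leqW.
  by exists n.+1 => // -[//|k] nk; rewrite -bxy; exact: tn.
rewrite -tailxy; case: asboolP => [[n _ tn]|ntail].
  rewrite /colB; have [tx minx] := @first_timeP _ tail x (ex_intro _ n tn).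
  case: (first_time tail x) tx minx => [|m] tx minx.
    have ty : tail 0%N y by move=> k _; rewrite bxy; exact: tx.
    rewrite (first_time_eq ty)//=.
    rewrite (_ : (fun k => Y y _) = shift (fun k => Y x (k + 0)%N)).
      by apply: extend_neq cP _ => k; rewrite /= !addn0; apply/negP; exact: tx.
    by apply/funext => k; rewrite /shift !addn0 Yxy.
  have ty : tail m y by move=> k mk; rewrite bxy; exact: tx.
  rewrite (first_time_eq ty) => [|k km tk]; last first.
    by apply: (minx k.+1) => // -[//|i] ki; rewrite -bxy; exact: tk.
  rewrite iterS (_ : (fun k => Y x _) = fun k => Y y (k + m)%N).
    exact: rot.
  by apply/funext => k; rewrite Yxy addnS.
(* Without a mark, all the steps after a good one are good. *)
have exmark z : ~ (\bigcup_n tail n) z -> exists n, mark n z.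
  move=> ntz; apply: contrapT => nmark.
  have [k bk] : exists k, ~ b z k.
    apply: contrapT => h; apply: ntz; exists 0%N => // k _.
    by apply: contrapT => nb; apply: h; exists k.
  have nb m : ~ b z (k + m)%N.
    elim: m => [|m ih]; first by rewrite addn0.
    by rewrite addnS => bm; apply: nmark; exists (k + m)%N.
  have badz i : ~ ((set_val z i : finseq Q) <= set_val z i.+1)%O.
    by apply/negP; exact: (set_valP z).
  have [m km] := lead_infinitely_bad badz k.
  by rewrite -(subnKC km); exact: nb.
have [Mx minx] := @first_timeP _ mark x (exmark x ntail).
have [My miny] : mark (first_time mark y) y /\
    forall m, (m < first_time mark y)%N -> ~ mark m y.
  by apply/first_timeP/exmark; rewrite -tailxy.
have mxy n : mark n y = mark n.+1 x by rewrite /mark /= !bxy.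
have colE (i j : nat) :
    (i < 3)%N -> (j < 3)%N -> i != j -> inord i <> inord j :> 'I_3.
  move=> i3 j3 ij /(congr1 (@nat_of_ord 3)); rewrite !inordK// => /eqP.
  exact/negP.
have odd3 n : (odd n < 3)%N by case: odd.
rewrite /colA; case: (first_time mark x) Mx minx => [|m] Mx minx /=.
  case: (first_time mark y) My => [[]|m _].
    by rewrite bxy; case: Mx.
  by apply: colE => //; case: odd.
rewrite (@first_time_eq _ mark y m).
- case: m {Mx minx} => [|m] /=; first exact: colE.
  by apply: colE => //; case: odd.
- by rewrite mxy.
- by move=> k km; rewrite mxy; exact: minx.
Qed.

End Colouring.

(** * Colourings with three colours and Borel chromatic numbers *)

(** Makes every subset of a finite colouring space Borel, so that its points can
    be renamed. *)
Lemma polish_set1_closed (R : realType) (Y : topologicalType) (y : Y) :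
  polish R Y -> closed [set y].
Proof.
move=> [_ [M [f [bijf openf _]]]].
have -> : [set y] = f @^-1` [set f y].
  by apply/seteqP; split => x /= [] => [->//|/(bij_inj bijf)].
rewrite -openC preimage_setC; apply/openf; rewrite openC.
exact/accessible_closed_set1/hausdorff_accessible/metric_hausdorff.
Qed.

Lemma shift_colorable_of_chromatic (R : realType) (d : Order.disp_t)
    (Q : preorderType d) :
  borel_chromatic_number_le R (@bad_seq_adj d Q) 3 -> shift_colorable Q.
Proof.
move=> [Y [[polY [c bc cP]] _]]; rewrite -(card_le_eqr card_II).
move=> /pcard_leP/unsquash e.
have e3 y : (e y < 3)%N by exact: (@funS _ _ _ _ e y I).
have /in2TT einj := @inj _ _ _ e.
have bfib P : borel [set y | P (inord (e y) : 'I_3)].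
  have bn n : borel [set y | e y = n /\ P (inord n : 'I_3)].
    have [[y [yn Pn]]|nex] := pselect (exists y, e y = n /\ P (inord n : 'I_3)).
      rewrite (_ : [set _ | _] = ~` ~` [set y]).
        apply borelC, borel_open; rewrite openC.
        exact: polish_set1_closed polY.
      rewrite setCK; apply/seteqP; split => x /= => [[xn _]|->//].
      exact/einj/(etrans xn).
    rewrite (_ : [set _ | _] = set0); first exact: borel0.
    by apply/seteqP; split => // x xP; apply: nex; exists x.
  have := borel_bigcup bn; congr borel; apply/seteqP; split => y /=.
    by move=> [n _ [<-]].
  by exists (e y).
exists (fun z => inord (e (c z))); split.
  by split=> P; exact: (bc _ (bfib P)).
move=> z z' zz' /(congr1 (@nat_of_ord 3)); rewrite !inordK// => /einj.
apply: cP; split; last by left.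
move=> zz; have /negP := set_valP z 0%N; apply.
have z01 : set_val z 0%N = set_val z 1%N by rewrite {1}zz -zz'.
exact: (eq_ind _ (fun q : Q => (set_val z 0%N : Q) <= q)%O (lexx _) _ z01).
Qed.

(** R is a phantom parameter, from which the instance of the metric with values
    in R can be inferred. *)
Definition discrete_metric (R : realType) (T : choiceType) : Type := T.
HB.instance Definition _ R (T : choiceType) := Choice.on (discrete_metric R T).

Section DiscreteMetric.
Context (R : realType) (T : choiceType).
Import GRing.Theory Num.Theory.
Local Open Scope ring_scope.

Let dist (x y : discrete_metric R T) : R := (x != y)%:R.

Let dist_refl x : dist x x = 0. Proof. by rewrite /dist eqxx. Qed.

Let dist_eq0 x y : dist x y = 0 -> x = y.
Proof. by rewrite /dist; case: eqVneq => // _ /eqP; rewrite oner_eq0. Qed.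

Let dist_sym x y : dist x y = dist y x. Proof. by rewrite /dist eq_sym. Qed.

Let dist_triangle y x z : dist x z <= dist x y + dist y z.
Proof.
rewrite /dist; case: (eqVneq x z) => [_|xz]; first by rewrite addr_ge0.
case: (eqVneq x y) => [<-|xy]; first by rewrite xz add0r.
by rewrite lerDl.
Qed.

HB.instance Definition _ := isMetric.Build R (discrete_metric R T)
  dist_refl dist_eq0 dist_sym dist_triangle.

Lemma discrete_metric_ball (x y : discrete_metric R T) : ball x 1 y -> x = y.
Proof.
by rewrite ballEmdist /= /mdist /= /dist; case: eqVneq => //; rewrite ltxx.
Qed.

Lemma polish_discrete_metric :
  countable [set: T] -> polish R (discrete_metric R T).
Proof.
move=> cT; split; first by exists setT => // U U0 _; rewrite setIT.
exists (discrete_metric R T), id; split=> //; first by exists id.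
move=> u /cauchyP/(_ 1 ltr01)[x [N _ ux]]; exists x => U /nbhs_singleton Ux.
by exists N => // n Nn /=; rewrite -(discrete_metric_ball (ux n Nn)).
Qed.

End DiscreteMetric.
(** Among the n for which some colouring space has at most n points, take the
    least: a space Y with that many points embeds in any colouring space,
    whether infinite or finite. *)
Lemma chromatic_of_shift_colorable (R : realType) (d : Order.disp_t)
    (Q : preorderType d) :
  shift_colorable Q -> borel_chromatic_number_le R (@bad_seq_adj d Q) 3.
Proof.
move=> [c [bc cP]].
pose colorable n := exists Y,
  borel_colorable_by R (@bad_seq_adj d Q) Y /\ [set: Y] #<= `I_n.
have col3 : colorable 3.
  exists (discrete_metric R 'I_3); split.
    split; first by apply: polish_discrete_metric; exact: countableP.
    exists c; first by move=> B _; exact: (borel_preimage bc B).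
    by move=> x y [_ [xy|yx]]; [exact: cP|apply: nesym; exact: cP].
  by rewrite (card_le_eqr card_II); exact: card_lexx.
have ex : exists n, `[< colorable n >] by exists 3; apply/asboolP.
case: (ex_minnP ex) => n /asboolP[Y [colY Yn]] min; exists Y; last first.
  rewrite -(card_le_eqr card_II); apply: (card_le_trans Yn).
  by rewrite card_le_II; apply: min; apply/asboolP.
split=> // Z colZ; apply: (card_le_trans Yn).
have [/finite_setP[m Zm]|/infiniteP] := pselect (finite_set [set: Z]).
  rewrite (card_le_eqr Zm) card_le_II; apply: min; apply/asboolP; exists Z.
  by split=> //; rewrite -(card_le_eqr Zm); exact: card_lexx.
by apply: card_le_trans; exact: card_leT.
Qed.

Theorem theorem3p6 (R : realType) (d : Order.disp_t) (Q : preorderType d)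
  (Q_countable : countable [set: Q]) (Q_bqo : bqo Q) (Q_thin : thin R Q) :
  thin R (finseq Q).
Proof.
split; first exact: countable_finseq.
  exact: bqo_finseq.
apply/chromatic_of_shift_colorable/shift_colorable_finseq => //.
by case: Q_thin => _ _; exact: shift_colorable_of_chromatic.
Qed.
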